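(* Let $n,k\in\mathbb{N}$ with $n\ge 3$ and $k\ge 2$, and let $MC_n^k$ be the multilayered cycle. Then the strong vertex span and the direct vertex span of $MC_n^k$ satisfy $$\sigma^{\boxtimes}_V(MC_n^k)=\sigma^{\times}_V(MC_n^k)=\left\lfloor\frac{n}{2}\right\rfloor+1.$$
   Context: For $n\ge3$, $k\ge2$, the multilayered cycle $MC_n^k$ is the graph with vertex set $\{(i,j): i\in\mathbb{Z}_n,\ j\in\{1,\dots,k\}\}$ in which $(a,b)$ and $(c,d)$ are adjacent iff either $a=c$ and $|d-b|=1$, or $b=d$ and $|a-c|\in\{1,n-1\}$ (i.e. $a-c\equiv\pm1 \pmod n$). Write $\mathbb{N}_l=\{1,\dots,l\}$ and let $d$ denote the shortest-path distance in the graph. For a graph $G$ and $l\in\mathbb{N}$: an $l$-track is a surjective map $f:\mathbb{N}_l\to V(G)$ with $f(i)f(i+1)\in E(G)$ for all $i\in\mathbb{N}_{l-1}$; a lazy $l$-track is a surjective map $f:\mathbb{N}_l\to V(G)$ with $f(i)f(i+1)\in E(G)$ or $f(i)=f(i+1)$ for all $i\in\mathbb{N}_{l-1}$. For two maps $f,g:\mathbb{N}_l\to V(G)$ set $m_G(f,g)=\min\{d(f(i),g(i)): i\in\mathbb{N}_l\}$. The strong vertex span $\sigma^{\boxtimes}_V(G)$ is the maximum of $m_G(f,g)$ over all $l\in\mathbb{N}$ and all pairs $f,g$ of lazy $l$-tracks on $G$. The direct vertex span $\sigma^{\times}_V(G)$ is the maximum of $m_G(f,g)$ over all $l\in\mathbb{N}$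 and all pairs $f,g$ of $l$-tracks on $G$. *)

(* Defs.v *)
From mathcomp Require Import all_boot all_order all_algebra.

Set Implicit Arguments.
Unset Strict Implicit.
Unset Printing Implicit Defensive.

Import IntDist.

Section Spans.

(* A finite graph is given by its adjacency relation e on the vertex type V. *)
Variables (V : finType) (e : rel V).

Definition walk (m : nat) (x y : V) : bool :=
  [exists p : m.-tuple V, path e x p && (last x p == y)].

(* The least length of a walk from x to y. A shortest walk repeats no vertex,
   so its length is below #|V|; the value is #|V| when no walk exists. *)
Definition gdist (x y : V) : nat :=
  find (fun m => walk m x y) (iota 0 #|V|).

(* On a nonempty graph no map from N_0 is surjective, so only l >= 1 matters;
   N_(l+1) = {1, ..., l+1} is represented by 'I_l.+1 = {0, ..., l}. *)
Definition surj (l : nat) (f : 'I_l.+1 -> V) : Prop :=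
  forall v : V, exists i : 'I_l.+1, f i = v.

Definition track (l : nat) (f : 'I_l.+1 -> V) : Prop :=
  surj f /\
  forall i j : 'I_l.+1, j = i.+1 :> nat -> e (f i) (f j).

Definition lazy_track (l : nat) (f : 'I_l.+1 -> V) : Prop :=
  surj f /\
  forall i j : 'I_l.+1, j = i.+1 :> nat -> e (f i) (f j) \/ f i = f j.

(* The initial value of the iteration is itself one of the terms. *)
Definition min_dist (l : nat) (f g : 'I_l.+1 -> V) : nat :=
  \big[minn/gdist (f ord0) (g ord0)]_(i < l.+1) gdist (f i) (g i).

Definition is_maximum (S : nat -> Prop) (s : nat) : Prop :=
  S s /\ forall m : nat, S m -> m <= s.

Definition is_strong_vertex_span (s : nat) : Prop :=
  is_maximum
    (fun m => exists (l : nat) (f g : 'I_l.+1 -> V),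
       [/\ lazy_track f, lazy_track g & min_dist f g = m]) s.

Definition is_direct_vertex_span (s : nat) : Prop :=
  is_maximum
    (fun m => exists (l : nat) (f g : 'I_l.+1 -> V),
       [/\ track f, track g & min_dist f g = m]) s.

Lemma is_maximum_unique (S : nat -> Prop) (s t : nat) :
  is_maximum S s -> is_maximum S t -> s = t.
Proof.
move=> [Ss ms] [St mt]; apply/eqP.
by rewrite eqn_leq mt // ms.
Qed.

Lemma walkP (m : nat) (x y : V) :
  reflect (exists p : seq V, [/\ size p = m, path e x p & last x p = y])
          (walk m x y).
Proof.
apply: (iffP existsP) => [[p /andP[ep /eqP lp]]|[p [sp ep lp]]].
  by exists p; rewrite size_tuple.
by exists (tcast sp (in_tuple p)); rewrite val_tcast /= ep lp /=.
Qed.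

Lemma gdist_le (m : nat) (x y : V) : walk m x y -> gdist x y <= m.
Proof.
move=> w; rewrite leqNgt; apply/negP => lt_m.
have m_lt : m < #|V|.
  by apply: leq_trans lt_m _; rewrite -[leqRHS](size_iota 0) find_size.
by have := before_find 0 lt_m; rewrite nth_iota // w.
Qed.

Lemma gdist_walk (x y : V) : connect e x y -> walk (gdist x y) x y.
Proof.
case/connectP => p ep ->; case/shortenP: ep => q eq uq _.
have lt_q : size q < #|V|.
  by have := card_uniqP uq; rewrite /= => <-; apply: max_card.
have hw : has (fun m => walk m x (last x q)) (iota 0 #|V|).
  apply/hasP; exists (size q); first by rewrite mem_iota.
  by apply/walkP; exists q.
have := nth_find 0 hw; rewrite nth_iota //.
by move: hw; rewrite has_find size_iota.
Qed.

End Spans.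

(* Z_n is represented by its residues 0, ..., n-1, and the layers {1, ..., k}
   by {0, ..., k-1}. *)
Definition mc_adj (n k : nat) : rel ('I_n * 'I_k) :=
  fun u v =>
    ((u.1 == v.1) && (`|v.2 - u.2| == 1)) ||
    ((u.2 == v.2) && ((`|u.1 - v.1| == 1) || (`|u.1 - v.1| == n - 1))).

Lemma mc_adj_sym (n k : nat) : symmetric (@mc_adj n k).
Proof.
by move=> u v; rewrite /mc_adj eq_sym (distnC v.2) [u.2 == _]eq_sym (distnC u.1).
Qed.

Lemma mc_adj_irr (n k : nat) : 1 < n -> irreflexive (@mc_adj n k).
Proof. by move=> n_gt1 u; rewrite /mc_adj !eqxx !distnn /= eq_sym subn_eq0 leqNgt n_gt1. Qed.

(* Main.v *)
Require Import Defs.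
From mathcomp Require Import all_boot all_order all_algebra.
From mathcomp Require Import zify.

Import IntDist.

(** The distance on the multilayered cycle is the cyclic distance of the columns
    plus the distance of the layers, so it is at most [n %/ 2] plus the latter.

    Upper bound: each player visits both extreme layers, so the difference of
    the two layers is nonnegative at some time and nonpositive at another one.
    Each step changes it by at most 2, so it cannot jump from [>= 2] to
    [<= -2] and lies in [{-1, 0, 1}] at some time.

    Lower bound: both players alternate a full turn around their current layer
    with a simultaneous change of layer, always staying [n %/ 2] columns apart.
    The players visit the layers 1, 0, 1, ..., k-1 and 0, 1, ..., k-1, k-2
    respectively, so their layers always differ by exactly 1. *)

Section GraphDistance.

Variables (V : finType) (e : rel V) (d : V -> V -> nat).
Hypotheses (d_eq0 : forall x y, d x y = 0 -> x = y) (d_refl : forall x, d x x = 0).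
Hypothesis d_adj : forall x y z, e x y -> d x z <= (d y z).+1.
Hypothesis d_step : forall x y, 0 < d x y -> exists2 z, e x z & d x y = (d z y).+1.

(** Following [d_step] down to 0 builds a walk of length [d x y]; by [d_adj] an edge lowers [d] by
    at most 1, so no walk is shorter. *)
Lemma gdist_eq x y : gdist e x y = d x y.
Proof.
have walk_d m : forall u, d u y = m -> walk e m u y.
  elim: m => [|m IHm] u duy.
    by apply/walkP; exists [::]; split=> //=; exact: d_eq0.
  have [|z euz] := @d_step u y; first by rewrite duy.
  rewrite duy => -[/esym/IHm/walkP[p [sp ep lp]]].
  by apply/walkP; exists (z :: p); rewrite /= sp euz.
have d_walk p : forall u, path e u p -> last u p = y -> d u y <= size p.
  elim: p => [|z p IHp] u /=; first by move=> _ ->; rewrite d_refl.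
  case/andP=> euz ep lp; apply: leq_trans (d_adj _ _ y euz) _.
  by rewrite ltnS IHp.
apply/eqP; rewrite eqn_leq gdist_le ?walk_d //=.
(* Connectedness rules out the default value [#|V|]: [gdist] is the length of an actual walk. *)
have /gdist_walk/walkP[p [<- ep lp]] : connect e x y; last exact: d_walk.
have /walkP[p [_ ep lp]] := walk_d _ x erefl.
by apply/connectP; exists p.
Qed.

End GraphDistance.

Lemma track_lazy (V : finType) (e : rel V) l (f : 'I_l.+1 -> V) :
  track e f -> lazy_track e f.
Proof. by move=> [sf tf]; split=> // i j /tf; left. Qed.

Lemma min_dist_const (V : finType) (e : rel V) l (f g : 'I_l.+1 -> V) s :
  (forall i, gdist e (f i) (g i) = s) -> min_dist e f g = s.
Proof.
move=> fgs; rewrite /min_dist fgs.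
by elim/big_ind: _ => // x y -> ->; rewrite minnn.
Qed.

Lemma min_dist_le (V : finType) (e : rel V) l (f g : 'I_l.+1 -> V) i :
  min_dist e f g <= gdist e (f i) (g i).
Proof.
rewrite /min_dist; have := mem_index_enum i.
elim: (index_enum _) => //= j s IHs; rewrite inE big_cons => /predU1P[->|/IHs].
  exact: geq_minl.
exact/leq_trans/geq_minr.
Qed.

Section CyclicDistance.

Variable n : nat.

Definition cyc_dist (x y : nat) : nat := minn `|x - y| (n - `|x - y|).

Definition cyc_adj (x y : nat) : bool := (`|x - y| == 1) || (`|x - y| == n - 1).

Lemma cyc_dist_le x y : cyc_dist x y <= n %/ 2.
Proof. by rewrite /cyc_dist; lia. Qed.

Lemma cyc_dist_eq0 x y : x < n -> y < n -> cyc_dist x y = 0 -> x = y.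
Proof. by rewrite /cyc_dist; lia. Qed.

Lemma cyc_dist_adj x y z :
  x < n -> y < n -> z < n -> cyc_adj x y -> cyc_dist x z <= (cyc_dist y z).+1.
Proof. by rewrite /cyc_dist /cyc_adj; lia. Qed.

Lemma cyc_dist_step x y : x < n -> y < n -> 0 < cyc_dist x y ->
  exists z, [/\ z < n, cyc_adj x z & cyc_dist x y = (cyc_dist z y).+1].
Proof.
rewrite /cyc_dist /cyc_adj => ltx lty xy.
(* The test holds when a shortest arc from [x] to [y] starts upwards, possibly passing from [n - 1]
   to 0. *)
have [up|down] := boolP ((x < y) == (`|x - y| <= n - `|x - y|)).
  by exists (if x == n.-1 then 0 else x.+1); case: ifP; split; lia.
by exists (if x == 0 then n.-1 else x.-1); case: ifP; split; lia.
Qed.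

Lemma cyc_adj_modS x : 1 < n -> cyc_adj (x %% n) (x.+1 %% n).
Proof.
move=> n_gt1; rewrite -addn1 -modnDml /cyc_adj.
have := ltn_pmod x (ltnW n_gt1); move: (x %% n) => r ltr.
have [->|neq] := eqVneq r n.-1; first by rewrite addn1 prednK ?modnn; lia.
by rewrite modn_small; lia.
Qed.

Lemma cyc_dist_antipode x :
  0 < n -> cyc_dist (x %% n) ((x + n %/ 2) %% n) = n %/ 2.
Proof.
move=> n_gt0; rewrite -modnDml /cyc_dist.
have := ltn_pmod x n_gt0; move: (x %% n) => r ltr.
(* Without wrapping the gap is [n %/ 2]; with wrapping it is [n - n %/ 2], so the other arc has
   length [n %/ 2]. *)
have [lt|ge] := ltnP (r + n %/ 2) n; first by rewrite modn_small; lia.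
by rewrite -(subnK ge) modnDr modn_small; lia.
Qed.

End CyclicDistance.

Section MultilayeredCycle.

Variables n k : nat.
Hypotheses (n_ge3 : 3 <= n) (k_ge2 : 2 <= k).

Notation V := ('I_n * 'I_k)%type.

Definition mc_dist (u v : V) : nat := cyc_dist n u.1 v.1 + `|u.2 - v.2|.

Lemma gdist_mc u v : gdist (@mc_adj n k) u v = mc_dist u v.
Proof.
apply: gdist_eq => {u v}.
- move=> [x a] [y b] /eqP; rewrite addn_eq0 => /andP[/eqP/= dxy /eqP dab].
  congr pair; apply: ord_inj; last lia.
  by apply: cyc_dist_eq0 dxy; exact: ltn_ord.
- by move=> [x a]; rewrite /mc_dist /cyc_dist !distnn min0n.
- move=> [x a] [y b] [z c]; rewrite /mc_adj /mc_dist /=.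
  case/orP=> /andP[/eqP-> ]; first lia.
  by move/(cyc_dist_adj _ _ _ _ (ltn_ord x) (ltn_ord y) (ltn_ord z)); lia.
- move=> [x a] [y b]; rewrite /mc_dist /=.
  (* Approach the column first, and change layers only once the columns agree. *)
  have [dxy ab|dxy _] := posnP (cyc_dist n x y); last first.
    have [z [ltz xz ->]] := cyc_dist_step _ _ _ (ltn_ord x) (ltn_ord y) dxy.
    by exists (Ordinal ltz, a); rewrite // /mc_adj /= eqxx -/(cyc_adj n x z) xz orbT.
  have ltc : (if a < b then a.+1 else a.-1) < k.
    by have := ltn_ord a; have := ltn_ord b; case: ifP; lia.
  by exists (x, Ordinal ltc); rewrite /mc_adj /= ?eqxx ?dxy; case: ifP ltc; lia.
Qed.

Lemma mc_lazy_layer l (f : 'I_l.+1 -> V) (i j : 'I_l.+1) :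
  lazy_track (@mc_adj n k) f -> j = i.+1 :> nat -> `|(f i).2 - (f j).2| <= 1.
Proof.
case=> _ tf /tf[|->]; last by rewrite distnn.
by rewrite distnC; case/orP=> /andP[]; [move=> _ /eqP-> | move/eqP->; rewrite distnn].
Qed.

Lemma mc_far_layers_le l (f g : 'I_l.+1 -> V) :
    lazy_track (@mc_adj n k) f -> lazy_track (@mc_adj n k) g ->
    (forall i, 1 < `|(f i).2 - (g i).2|) ->
  (f ord0).2 <= (g ord0).2.
Proof.
move=> tf tg far; rewrite leqNgt; apply/negP => gt0.
have above m (ltm : m < l.+1) : (g (Ordinal ltm)).2 < (f (Ordinal ltm)).2.
  elim: m ltm => [|m IHm] ltm.
    by rewrite (_ : Ordinal ltm = ord0) //; apply: ord_inj.
  have := IHm (ltnW ltm); have := far (Ordinal ltm); have := far (Ordinal (ltnW ltm)).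
  have := mc_lazy_layer l f (Ordinal (ltnW ltm)) (Ordinal ltm) tf erefl.
  have := mc_lazy_layer l g (Ordinal (ltnW ltm)) (Ordinal ltm) tg erefl.
  lia.
have n_gt0 : 0 < n by lia.
have k_gt0 : 0 < k by lia.
(* [f] reaches layer 0, and no layer lies below it. *)
have [[m ltm] fm] := tf.1 (Ordinal n_gt0, Ordinal k_gt0).
by have := above m ltm; rewrite fm.
Qed.

Lemma mc_lazy_min_dist_le l (f g : 'I_l.+1 -> V) :
    lazy_track (@mc_adj n k) f -> lazy_track (@mc_adj n k) g ->
  min_dist (@mc_adj n k) f g <= n %/ 2 + 1.
Proof.
move=> tf tg.
have [/existsP[i near]|/existsPn far] :=
  boolP [exists i : 'I_l.+1, `|(f i).2 - (g i).2| <= 1].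
  apply: leq_trans (min_dist_le _ _ _ _ _ i) _.
  by rewrite gdist_mc leq_add // cyc_dist_le.
have farfg i : 1 < `|(f i).2 - (g i).2| by rewrite ltnNge far.
have fargf i : 1 < `|(g i).2 - (f i).2| by rewrite distnC.
(* Used in both directions, the lemma makes the initial layers equal, against [farfg]. *)
have := farfg ord0; have := mc_far_layers_le _ _ _ tf tg farfg.
have := mc_far_layers_le _ _ _ tg tf fargf; lia.
Qed.

Section LayerSweep.

(* [c] is the starting column and [a] the sequence of layers; the time [i]
   decomposes as [t * n.+1 + r], where [t] counts the changes of layer and
   [r <= n] the columns passed on the current layer. *)
Variables (c : nat) (a : nat -> nat).

Fact sweep_column_proof i : (i %% n.+1 + c) %% n < n.
Proof. by rewrite ltn_mod; lia. Qed.

Hypothesis a_lt : forall t, a t < k.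

(** The length allows [k + 1] full turns, since one layer is visited twice. *)
Definition sweep (i : 'I_(k * n.+1 + n).+1) : V :=
  (Ordinal (sweep_column_proof i), Ordinal (a_lt (i %/ n.+1))).

Hypothesis a_step : forall t, t < k -> `|a t.+1 - a t| = 1.
Hypothesis a_onto : forall j, j < k -> exists2 t, t <= k & a t = j.

Lemma sweep_track : track (@mc_adj n k) sweep.
Proof.
split=> [[x j]|i i' ii'].
  have [t let_k atj] := a_onto j (ltn_ord j).
  have [r ltr rx] : exists2 r, r < n & (r + c) %% n = x.
    exists ((x + (n - c %% n)) %% n); first by rewrite ltn_mod; lia.
    have ltc : c %% n < n by rewrite ltn_mod; lia.
    by rewrite modnDml -(modnDmr _ c) -addnA (subnK (ltnW ltc)) modnDr modn_small.
  have lti : t * n.+1 + r < (k * n.+1 + n).+1.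
    by rewrite ltnS leq_add ?leq_mul2r ?let_k ?orbT // ltnW.
  exists (Ordinal lti); congr pair; apply: ord_inj => /=.
    by rewrite modnMDl (modn_small (ltnW ltr : r < n.+1)).
  by rewrite divnMDl // (divn_small (ltnW ltr : r < n.+1)) addn0.
rewrite /mc_adj /= -!val_eqE /= ii'.
have := ltn_ord i'; rewrite ii'.
have -> : (i : nat) = i %/ n.+1 * n.+1 + i %% n.+1 by rewrite -divn_eq.
have := ltn_pmod i (ltn0Sn n); move: (i %/ n.+1) (i %% n.+1) => t r ltr lti.
(* At [r = n] the turn has closed at column [c] modulo [n], where the next turn starts, so only the
   layer changes. *)
have [rn|neq_rn] := eqVneq r n.
  have tk : t < k by rewrite -(ltn_pmul2r (ltn0Sn n)); lia.
  have -> : (t * n.+1 + r).+1 = t.+1 * n.+1 by lia.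
  rewrite modnMl mulnK // modnMDl (modn_small ltr).
  rewrite divnMDl // (divn_small ltr) addn0.
  by rewrite a_step // rn modnDl add0n !eqxx.
have ltr1 : r.+1 < n.+1 by lia.
rewrite -addnS !modnMDl !divnMDl // (modn_small ltr) (divn_small ltr).
rewrite (modn_small ltr1) (divn_small ltr1) eqxx addSn.
by rewrite -/(cyc_adj n _ _) cyc_adj_modS ?orbT; lia.
Qed.

End LayerSweep.

Lemma mc_tracks_far_apart : exists l (f g : 'I_l.+1 -> V),
  [/\ track (@mc_adj n k) f, track (@mc_adj n k) g &
      min_dist (@mc_adj n k) f g = n %/ 2 + 1].
Proof.
(* The minimum with [k.-1] only matters for [t > k], beyond the sweep; it keeps [a t < k] for every
   [t]. *)
pose a t := if t is 0 then 1 else minn t.-1 k.-1.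
pose b t := if t < k then t else k - 2.
have a_lt t : a t < k by rewrite /a; case: t; lia.
have b_lt t : b t < k by rewrite /b; case: ifP; lia.
exists (k * n.+1 + n), (sweep 0 a a_lt), (sweep (n %/ 2) b b_lt); split.
- apply: sweep_track => [[|t] |j ltj]; rewrite /a; try lia.
  by exists j.+1; lia.
- apply: sweep_track => [t|j ltj]; rewrite /b; first by do 2 case: ifP; lia.
  by exists j; rewrite ?ltj; lia.
apply: min_dist_const => i; rewrite gdist_mc /mc_dist /= addn0.
rewrite cyc_dist_antipode; last lia.
congr (_ + _); have : i %/ n.+1 <= k.
  by rewrite -ltnS ltn_divLR //; have := ltn_ord i; lia.
by rewrite /a /b; case: (i %/ n.+1) => [|t] letk; case: ifP; lia.
Qed.

End MultilayeredCycle.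

Theorem theorem2 (n k : nat) (hn : 3 <= n) (hk : 2 <= k) :
  is_strong_vertex_span (@mc_adj n k) (n %/ 2 + 1) /\
  is_direct_vertex_span (@mc_adj n k) (n %/ 2 + 1).
Proof.
(* As tracks are lazy tracks, this pair attains the value for both spans, and the bound for lazy
   tracks limits both. *)
have [l [f [g [tf tg fg]]]] := mc_tracks_far_apart n k hn hk.
split; split.
- by exists l, f, g; split=> //; exact: track_lazy.
- by move=> _ [l' [f' [g' [tf' tg' <-]]]]; exact: mc_lazy_min_dist_le.
- by exists l, f, g.
- move=> _ [l' [f' [g' [tf' tg' <-]]]].
  by apply: mc_lazy_min_dist_le => //; exact: track_lazy.
Qed.
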